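(* $P(\omega)/\triangle_d$ has no $(\omega,\omega)$-gaps.
   Context: $\omega$ is the set of non-negative integers. A set $A\subseteq\omega$ has asymptotic density zero if $\lim_{n\to\infty}\frac{|A\cap n|}{n}=0$ (where $n=\{0,\dots,n-1\}$); $\triangle_d$ is the ideal of subsets of $\omega$ of asymptotic density zero and $P(\omega)/\triangle_d$ is the quotient Boolean algebra. Let $\mathbb{B}$ be a Boolean algebra with zero $\mathbb{O}$. A gap (or cut) is a pair $\langle S,T\rangle$ with $S,T\subseteq\mathbb{B}$ such that $a\cdot b=\mathbb{O}$ for all $a\in S$, $b\in T$. An element $c\in\mathbb{B}$ fills (or separates) $\langle S,T\rangle$ if $a\leq c$ and $c\cdot b=\mathbb{O}$ for all $a\in S$, $b\in T$. A $(\kappa,\lambda)$-gap is such a pair $\langle S,T\rangle$ with $|S|=\kappa$, $|T|=\lambda$ that is not separated by any $c\in\mathbb{B}$. *)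

(* Defs.v *)
From HB Require Import structures.
From mathcomp Require Import all_boot all_order all_algebra finmap.
From mathcomp Require Import generic_quotient.
From mathcomp Require Import boolp classical_sets functions cardinality reals.
From mathcomp Require Import topology normedtype sequences.

Set Implicit Arguments.
Unset Strict Implicit.
Unset Printing Implicit Defensive.

Import Order.TTheory GRing.Theory Num.Theory numFieldNormedType.Exports.

Local Open Scope classical_set_scope.
Local Open Scope ring_scope.
Local Open Scope quotient_scope.
Local Open Scope card_scope.

Section DensityZero.
Context (R : realType).
Implicit Types A B C D : set nat.

Definition count_below A n : nat := #|` fset_set (A `&` `I_n)|%fset.

(* The value at n = 0 is 0 (division by 0) and does not affect the limit. *)
Definition density_zero A : Prop :=
  ((count_below A n)%:R / n%:R : R) @[n --> \oo] --> (0 : R).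

Lemma count_below_le A B n : A `<=` B -> (count_below A n <= count_below B n)%N.
Proof.
move=> AB; apply: fsubset_leq_card.
have fI (C : set nat) : finite_set (C `&` `I_n).
  by apply: finite_setIr; apply: finite_II.
by rewrite -fset_set_sub//; apply: setSI.
Qed.

Lemma count_belowU A B n :
  (count_below (A `|` B) n <= count_below A n + count_below B n)%N.
Proof.
have fI (C : set nat) : finite_set (C `&` `I_n).
  by apply: finite_setIr; apply: finite_II.
by rewrite /count_below setIUl fset_setU// -cardfsUI leq_addr.
Qed.

Lemma density_zero0 : density_zero set0.
Proof.
rewrite /density_zero /count_below.
under eq_fun do rewrite set0I fset_set0 cardfs0 mul0r.
exact: cvg_cst.
Qed.

Lemma density_zeroS A B : A `<=` B -> density_zero B -> density_zero A.
Proof.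
move=> AB dB; apply: (squeeze_cvgr _ (cvg_cst 0) dB).
apply: nearW => n; rewrite divr_ge0//= ler_wpM2r ?invr_ge0// ler_nat.
exact: count_below_le.
Qed.

Lemma density_zeroU A B :
  density_zero A -> density_zero B -> density_zero (A `|` B).
Proof.
move=> dA dB.
pose r C n : R := (count_below C n)%:R / n%:R.
have dAB : r A \+ r B @ \oo --> (0 : R).
  by rewrite -[0](addr0 0); exact: (@cvgD _ R^o _ _ _ (r A) (r B)).
apply: (squeeze_cvgr _ (cvg_cst 0) dAB).
apply: nearW => n; rewrite divr_ge0//= /r -mulrDl ler_wpM2r ?invr_ge0//.
by rewrite -natrD ler_nat count_belowU.
Qed.

Definition density_equiv A B : bool := `[< density_zero (A `+` B) >].

Lemma density_equivP A B :
  reflect (density_zero (A `+` B)) (density_equiv A B).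
Proof. exact: asboolP. Qed.

Lemma density_equiv_refl : reflexive density_equiv.
Proof. by move=> A; apply/density_equivP; rewrite setYK; exact: density_zero0. Qed.

Lemma density_equiv_sym : symmetric density_equiv.
Proof. by move=> A B; rewrite /density_equiv setYC. Qed.

Lemma density_equiv_trans : transitive density_equiv.
Proof.
move=> B A C /density_equivP AB /density_equivP BC; apply/density_equivP.
apply: density_zeroS (density_zeroU AB BC) => x; rewrite /setY /setU /setD /=.
by case: (pselect (B x)); tauto.
Qed.

Canonical density_equiv_rel := EquivRel density_equiv
  density_equiv_refl density_equiv_sym density_equiv_trans.

Lemma density_equiv_bin (op : set nat -> set nat -> set nat) :
  (forall A B C D, op A B `+` op C D `<=` (A `+` C) `|` (B `+` D)) ->
  forall A B C D, density_equiv A C -> density_equiv B D ->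
    density_equiv (op A B) (op C D).
Proof.
move=> opP A B C D /density_equivP AC /density_equivP BD; apply/density_equivP.
exact: density_zeroS (opP _ _ _ _) (density_zeroU AC BD).
Qed.

Lemma density_equivI A B C D : density_equiv A C -> density_equiv B D ->
  density_equiv (A `&` B) (C `&` D).
Proof.
apply: (@density_equiv_bin (@setI nat)) => {}A {}B {}C {}D x.
rewrite /setY /setU /setD /setI /=.
by case: (pselect (A x)); case: (pselect (C x)); tauto.
Qed.

Lemma density_equivU A B C D : density_equiv A C -> density_equiv B D ->
  density_equiv (A `|` B) (C `|` D).
Proof.
apply: (@density_equiv_bin (@setU nat)) => {}A {}B {}C {}D x.
by rewrite /setY /setU /setD /=; tauto.
Qed.

Lemma density_equivC A C : density_equiv A C -> density_equiv (~` A) (~` C).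
Proof.
move=> /density_equivP dAC; apply/density_equivP; apply: density_zeroS dAC => x.
rewrite /setY /setU /setD /setC /=.
by case: (pselect (A x)); case: (pselect (C x)); tauto.
Qed.

End DensityZero.

Section QuotientAlgebra.
Context (R : realType).

Definition Pomega_mod_density : Type := {eq_quot (density_equiv_rel R)}.
Local Notation Q := Pomega_mod_density.

HB.instance Definition _ := Choice.on Q.
HB.instance Definition _ : EqQuotient _ (density_equiv R) Q :=
  EqQuotient.on Q.

Lemma Pomega_mod_densityP (A B : set nat) :
  \pi_Q A = \pi_Q B <-> density_zero R (A `+` B).
Proof. by split=> [/eqmodP/density_equivP|/density_equivP/eqmodP]. Qed.

Definition qmeet := lift_op2 Q (@setI nat).
Definition qjoin := lift_op2 Q (@setU nat).
Definition qcompl := lift_op1 Q (@setC nat).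

Lemma pi_qmeet : {morph \pi_Q : A B / A `&` B >-> qmeet A B}.
Proof.
by move=> A B; unlock qmeet; apply/eqmodP/density_equivI;
  apply/eqmodP; rewrite reprK.
Qed.

Lemma pi_qjoin : {morph \pi_Q : A B / A `|` B >-> qjoin A B}.
Proof.
by move=> A B; unlock qjoin; apply/eqmodP/density_equivU;
  apply/eqmodP; rewrite reprK.
Qed.

Lemma pi_qcompl : {morph \pi_Q : A / ~` A >-> qcompl A}.
Proof.
by move=> A; unlock qcompl; apply/eqmodP/density_equivC;
  apply/eqmodP; rewrite reprK.
Qed.

Definition qle (x y : Q) := qmeet x y == x.
Definition qlt (x y : Q) := (y != x) && qle x y.

Fact qmeetC : commutative qmeet.
Proof. by elim/quotW=> A; elim/quotW=> B; rewrite -!pi_qmeet setIC. Qed.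

Fact qjoinC : commutative qjoin.
Proof. by elim/quotW=> A; elim/quotW=> B; rewrite -!pi_qjoin setUC. Qed.

Fact qmeetA : associative qmeet.
Proof.
by elim/quotW=> A; elim/quotW=> B; elim/quotW=> C; rewrite -!pi_qmeet setIA.
Qed.

Fact qjoinA : associative qjoin.
Proof.
by elim/quotW=> A; elim/quotW=> B; elim/quotW=> C; rewrite -!pi_qjoin setUA.
Qed.

Fact qjoinKI (y x : Q) : qmeet x (qjoin x y) = x.
Proof.
by elim/quotW: x => A; elim/quotW: y => B; rewrite -pi_qjoin -pi_qmeet setUC setKU.
Qed.

Fact qmeetKU (y x : Q) : qjoin x (qmeet x y) = x.
Proof.
by elim/quotW: x => A; elim/quotW: y => B; rewrite -pi_qmeet -pi_qjoin setIC setKI.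
Qed.

Fact qmeetUl : left_distributive qmeet qjoin.
Proof.
elim/quotW=> A; elim/quotW=> B; elim/quotW=> C.
by rewrite -pi_qjoin -!pi_qmeet -pi_qjoin setIUl.
Qed.

Fact qmeetxx : idempotent_op qmeet.
Proof. by elim/quotW=> A; rewrite -pi_qmeet setIid. Qed.

Fact Pomega_display : Order.disp_t. Proof. exact: Order.Disp tt tt. Qed.

HB.instance Definition _ := Order.isMeetJoinDistrLattice.Build Pomega_display Q
  (fun _ _ => erefl) (fun _ _ => erefl)
  qmeetC qjoinC qmeetA qjoinA qjoinKI qmeetKU qmeetUl qmeetxx.

Fact qle0x (x : Q) : (\pi_Q (set0 : set nat) <= x)%O.
Proof.
by elim/quotW: x => A; apply/eqP; rewrite -[LHS]/(qmeet _ _) -pi_qmeet set0I.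
Qed.

Fact qlex1 (x : Q) : (x <= \pi_Q (setT : set nat))%O.
Proof.
by elim/quotW: x => A; apply/eqP; rewrite -[LHS]/(qmeet _ _) -pi_qmeet setIT.
Qed.

HB.instance Definition _ := Order.hasBottom.Build Pomega_display Q qle0x.
HB.instance Definition _ := Order.hasTop.Build Pomega_display Q qlex1.

Fact qjoinxC (x : Q) : Order.join x (qcompl x) = \top%O.
Proof.
by elim/quotW: x => A; rewrite -[LHS]/(qjoin _ _) -pi_qcompl -pi_qjoin setUv.
Qed.

Fact qmeetxC (x : Q) : Order.meet x (qcompl x) = \bot%O.
Proof.
by elim/quotW: x => A; rewrite -[LHS]/(qmeet _ _) -pi_qcompl -pi_qmeet setICr.
Qed.

HB.instance Definition _ :=
  Order.TBDistrLattice_hasComplement.Build Pomega_display Q qjoinxC qmeetxC.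

Lemma Pomega_meetE (A B : set nat) :
  Order.meet (\pi_Q A) (\pi_Q B) = \pi_Q (A `&` B).
Proof. by rewrite pi_qmeet. Qed.

Lemma Pomega_bottomE : \bot%O = \pi_Q (set0 : set nat).
Proof. by []. Qed.

Lemma Pomega_leE (A B : set nat) :
  (\pi_Q A <= \pi_Q B)%O <-> density_zero R (A `\` B).
Proof.
have -> : A `\` B = (A `&` B) `+` A.
  by apply/seteqP; split=> x; rewrite /setY /setU /setD /setI /=;
    case: (pselect (B x)); tauto.
by rewrite -Pomega_mod_densityP -Pomega_meetE; split=> /eqP.
Qed.

End QuotientAlgebra.

Section Gaps.
Context {d : Order.disp_t} {B : ctbDistrLatticeType d}.
Implicit Types (S T : set B) (c : B).

Definition is_cut S T : Prop :=
  forall a b, S a -> T b -> Order.meet a b = \bot%O.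

Definition separates c S T : Prop :=
  (forall a, S a -> (a <= c)%O) /\
  (forall b, T b -> Order.meet c b = \bot%O).

(* The cardinals kappa and lambda are given as the cardinalities of the
   types K and L. *)
Definition is_gap (K L : Type) S T : Prop :=
  [/\ S #= [set: K], T #= [set: L], is_cut S T &
      ~ exists c, separates c S T].

End Gaps.

(* Main.v *)
Require Import Defs.
From mathcomp Require Import all_boot all_order all_algebra.
From mathcomp Require Import boolp classical_sets reals.
From mathcomp Require Import generic_quotient cardinality.

(** Only two features of the algebra matter: density zero sets form an ideal,
    and the power set being divided is sigma-complete.  Lift the two countable
    sides of a cut to sequences [A] and [B] of subsets of the integers, so that
    every [A i `&` B j] has density zero, and let [C] be the union over [i] of
    [A i] minus [B 0], ..., [B i].  What [A i] loses in this construction lies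
    in the finitely many overlaps [A i `&` B j] with [j <= i]; what [C] keeps
    of [B j] can only come from the stages [i < j], before [B j] started being
    removed, hence lies in the finitely many overlaps [A i `&` B j] with
    [i < j].  A finite union of density zero sets has density zero, so the
    class of [C] separates the cut. *)

Set Implicit Arguments.
Unset Strict Implicit.
Unset Printing Implicit Defensive.

Local Open Scope classical_set_scope.
Local Open Scope quotient_scope.
Local Open Scope card_scope.

Lemma density_zero_bigcup_ord (R : realType) (F : nat -> set nat) (n : nat) :
  (forall i, density_zero R (F i)) ->
  density_zero R (\bigcup_(i < n) F i).
Proof.
move=> dF; rewrite bigcup_mkord; apply: big_ind => //.
  exact: density_zero0.
by move=> X Y; exact: density_zeroU.
Qed.

(** Only finitely many [B j] are removed from a given [A i], and only finitely
    many stages of [C] can meet a given [B j]; hence each of the two errors is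
    covered by finitely many of the sets [A i `&` B j]. *)
Lemma density_zero_separation (R : realType) (A B : nat -> set nat) :
  (forall i j, density_zero R (A i `&` B j)) ->
  exists C : set nat, (forall i, density_zero R (A i `\` C)) /\
                      (forall j, density_zero R (C `&` B j)).
Proof.
move=> dAB; exists (\bigcup_i (A i `\` \bigcup_(j < i.+1) B j)); split=> [i|j].
  apply: density_zeroS (density_zero_bigcup_ord i.+1 (dAB i)) => x [Aix NCx].
  (* A point of [A i] that no [B j] with [j <= i] contains survives stage [i]. *)
  rewrite -setI_bigcupr; split=> //; apply: contrapT => NBx.
  by apply: NCx; exists i.
apply: density_zeroS (density_zero_bigcup_ord j (dAB^~ j)).
move=> x [[i _ [Aix NBx]] Bjx]; exists i => //=.
by rewrite ltnNge; apply/negP => le_ji; apply: NBx; exists j.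
Qed.

Lemma Pomega_pi_eq0 (R : realType) (A : set nat) :
  \pi_(Pomega_mod_density R) A = \bot%O <-> density_zero R A.
Proof. by rewrite Pomega_bottomE Pomega_mod_densityP setY0. Qed.

Lemma card_eq_nat_range (T : Type) (X : set T) :
  X #= [set: nat] -> exists f : nat -> T, X = range f.
Proof.
rewrite card_eq_sym => /card_bijP[f [g _ gK]].
exists (fun n => val (f (SigSub (in_setT n)))).
apply/seteqP; split=> [x Xx|_ [n _ <-]].
  exists (val (g (SigSub (mem_set Xx)))) => //.
  by rewrite (_ : SigSub _ = g (SigSub (mem_set Xx))) ?gK//; exact: val_inj.
exact/set_mem/valP.
Qed.

Theorem proposition2 (R : realType) :
  ~ exists S T : set (Pomega_mod_density R), is_gap nat nat S T.
Proof.
move=> [S [T [/card_eq_nat_range[a ->] /card_eq_nat_range[b ->] cut]]]; apply.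
have dab i j : density_zero R (repr (a i) `&` repr (b j)).
  by apply/Pomega_pi_eq0; rewrite -Pomega_meetE !reprK; apply: cut; eexists.
have [C [dAC dCB]] := density_zero_separation dab.
exists (\pi C); split=> _ [n _ <-].
  by rewrite -[a n]reprK; apply/Pomega_leE.
by rewrite -[b n]reprK Pomega_meetE; apply/Pomega_pi_eq0.
Qed.
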